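(* Let $r\geq 2$ and $k>2(r-1)$ be integers, and set $$f(x_1,x_2,\ldots,x_r)=x_r\,(x_{r-1}+x_r-2)\cdots[x_2+\cdots+x_r-2(r-2)]\,[x_1+\cdots+x_r-2(r-1)],$$ i.e. $f(x_1,\ldots,x_r)=\prod_{j=1}^{r}\big(x_j+x_{j+1}+\cdots+x_r-2(r-j)\big)$. Let $\mathbf{V}$ be the $\mathbb{Q}$-linear space (of rational functions in $x$) generated by $$\frac{1}{x^l},\ \frac{1}{(x+1)^l},\ \ldots,\ \frac{1}{(x+n)^l},\ \ldots\qquad (l\geq 1),$$ and let $\eta:\mathbf{V}\to\mathbf{V}$ be the $\mathbb{Q}$-linear transformation satisfying $$\eta\left(\frac{1}{(x+n)^l}\right)=\frac{1}{n+1}\left(\frac{1}{x^l}-\frac{1}{(x+n+1)^l}\right)\qquad\text{for all } n\geq 0,\ l\geq 1.$$ Then $$\sum_{\substack{k_1+\cdots+k_r=k\\ k_1,\ldots,k_r\geq 1}}f(k_1,\ldots,k_{r-1},k_r)\,\zeta^{\mathcal{C}}(k_1,\ldots,k_{r-1},1+k_r)=\underbrace{\eta\circ\cdots\circ\eta}_{r-1}\left(\frac{1}{x^{l}}\right)\Bigg|_{x=1},$$ where $l=k-2(r-1)$ and $\alpha(x)|_{x=t}$ means $\alpha(t)$ for a rational function $\alpha(x)$.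
   Context: For $r\geq 1$ and integers $k_1,\ldots,k_{r-1}\geq 1$, $k_r\geq 2$, the continuous multiple zeta value is the (convergent) real number $$\zeta^{\mathcal{C}}(k_1,\ldots,k_r)=\int\cdots\int_{[1,+\infty)^r}\frac{dx_1\cdots dx_r}{x_1^{k_1}(x_1+x_2)^{k_2}\cdots(x_1+\cdots+x_r)^{k_r}}.$$ The sum runs over tuples of positive integers $(k_1,\ldots,k_r)$ with sum $k$. The functions $1/(x+n)^l$ ($n\geq 0$, $l\geq 1$ integers) are linearly independent over $\mathbb{Q}$, so $\eta$ is well defined. *)

(* Defs.v *)
From HB Require Import structures.
From mathcomp Require Import all_boot all_order all_algebra.
From mathcomp Require Import all_classical all_reals all_analysis.
Set Implicit Arguments.
Unset Strict Implicit.
Unset Printing Implicit Defensive.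
Import Order.TTheory GRing.Theory Num.Theory.
Import numFieldNormedType.Exports.
Local Open Scope classical_set_scope.
Local Open Scope ring_scope.

Section lebesgue_tuple.
Context (R : realType).
Local Notation rT := (measurableTypeR R).

Definition cons_pair n (p : rT * n.-tuple rT) : n.+1.-tuple rT :=
  [tuple of p.1 :: p.2].

Definition uncons_pair n (t : n.+1.-tuple rT) : rT * n.-tuple rT :=
  (thead t, [tuple of behead t]).

(* The library has the product sigma-algebra on n-tuples but no measure on    *)
(* them; this one is characterized by lebesgue_tuple_box below.               *)
Fixpoint lebesgue_tuple n : set (n.-tuple rT) -> \bar R :=
  if n is m.+1 then
    pushforward (@product_measure1 _ _ rT (m.-tuple rT) R
        lebesgue_measure (lebesgue_tuple (n := m)))
      (@cons_pair m)
  else \d_[tuple].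

Lemma cons_pairK n : cancel (@cons_pair n) (@uncons_pair n).
Proof. by case=> x t; congr pair; apply: val_inj. Qed.

Lemma uncons_pairK n : cancel (@uncons_pair n) (@cons_pair n).
Proof. by move=> t; rewrite [RHS]tuple_eta; apply: val_inj. Qed.

Lemma measurable_cons_pair n : measurable_fun setT (@cons_pair n).
Proof. exact: measurable_cons. Qed.

Lemma measurable_uncons_pair n : measurable_fun setT (@uncons_pair n).
Proof.
apply: measurable_fun_pair => /=; first exact: measurable_tnth.
apply/measurable_fun_tnthP => i.
rewrite (_ : _ \o _ = (@tnth _ rT)^~ (lift ord0 i)).
  exact: measurable_tnth.
by apply/funext => t /=; rewrite [in RHS](tuple_eta t) tnthS.
Qed.

(* Measure_isSigmaFinite is also provided by the library for product_measure1,*)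
(* but canonical inference selects the instance for subprobabilities instead. *)
Lemma sigma_finite_product d1 d2 (T1 : measurableType d1)
    (T2 : measurableType d2) (m1 : {sigma_finite_measure set T1 -> \bar R})
    (m2 : {sigma_finite_measure set T2 -> \bar R}) :
  sigma_finite setT (product_measure1 m1 m2).
Proof.
have /sigma_finiteP[F [TF ndF Foo]] := sigma_finiteT m1.
have /sigma_finiteP[G [TG ndG Goo]] := sigma_finiteT m2.
exists (fun n => F n `*` G n).
  rewrite -setXTT TF TG predeqE => -[x y]; split.
    move=> [/= [n _ Fnx] [k _ Gky]]; exists (maxn n k) => //; split.
    - by move: x Fnx; exact/subsetPset/ndF/leq_maxl.
    - by move: y Gky; exact/subsetPset/ndG/leq_maxr.
  by move=> [n _ []/= ? ?]; split; exists n.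
move=> k; have [? ?] := Foo k; have [? ?] := Goo k.
split; first exact: measurableX.
by rewrite product_measure1E// lte_mul_pinfty// ge0_fin_numE.
Qed.

Lemma lebesgue_tuple_sigma_finite_measure n :
  {mu : {sigma_finite_measure set (n.-tuple rT) -> \bar R} |
    mu = lebesgue_tuple (n := n) :> (set (n.-tuple rT) -> \bar R)}.
Proof.
elim: n => [|n [mu mE]]; first by exists \d_[tuple].
pose m : {measure set (rT * n.-tuple rT)%type -> \bar R} :=
  @product_measure1 _ _ rT (n.-tuple rT) R lebesgue_measure mu.
have mc := @measurable_cons_pair n.
pose nu : {measure set (n.+1.-tuple rT) -> \bar R} :=
  measure_function_pushforward__canonical__measure_function_Measure m mc.
have sf : sigma_finite setT nu.
  have [F FT Ffin] : sigma_finite setT m by exact: sigma_finite_product.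
  exists (fun i => @uncons_pair n @^-1` F i).
    by rewrite -preimage_bigcup -FT preimage_setT.
  move=> i; have [mF Foo] := Ffin i; split.
    by rewrite -[X in measurable X]setTI; exact: measurable_uncons_pair.
  rewrite /nu /= /pushforward (_ : _ @^-1` _ = F i)//.
  by apply/funext => p /=; rewrite /preimage/= cons_pairK.
pose nu' := HB.pack_for (SigmaFiniteMeasure.type (n.+1.-tuple rT) R)
  (Measure.sort nu) (Measure_isSigmaFinite.Build _ _ _ _ sf).
by exists nu'; rewrite /= /nu /= /m mE.
Qed.

Section instances.
Variable n : nat.

Let lebesgue_tuple0 : lebesgue_tuple (n := n) set0 = 0%E.
Proof. by have [mu <-] := lebesgue_tuple_sigma_finite_measure n. Qed.

Let lebesgue_tuple_ge0 A : (0 <= lebesgue_tuple (n := n) A)%E.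
Proof. by have [mu <-] := lebesgue_tuple_sigma_finite_measure n. Qed.

Let lebesgue_tuple_sigma_additive :
  semi_sigma_additive (lebesgue_tuple (n := n)).
Proof.
have [mu <-] := lebesgue_tuple_sigma_finite_measure n.
exact: measure_semi_sigma_additive.
Qed.

HB.instance Definition _ := isMeasure.Build _ _ _ (@lebesgue_tuple n)
  lebesgue_tuple0 lebesgue_tuple_ge0 lebesgue_tuple_sigma_additive.

Let lebesgue_tuple_sigma_finite : sigma_finite setT (lebesgue_tuple (n := n)).
Proof.
have [mu <-] := lebesgue_tuple_sigma_finite_measure n.
exact: sigma_finiteT.
Qed.

HB.instance Definition _ := Measure_isSigmaFinite.Build _ _ _
  (@lebesgue_tuple n) lebesgue_tuple_sigma_finite.

End instances.

Lemma lebesgue_tuple_box n (A : 'I_n -> set rT) :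
  (forall i, measurable (A i)) ->
  lebesgue_tuple [set t : n.-tuple rT | forall i, A i (tnth t i)] =
  (\prod_(i < n) lebesgue_measure (A i))%E.
Proof.
elim: n A => [|n IH] A mA.
  by rewrite big_ord0 /= diracE mem_set// => -[].
rewrite big_ord_recl -(IH (fun i => A (lift ord0 i)))//= -product_measure1E//.
  congr product_measure1; apply/funext => -[x t]; apply/propext; split.
    move=> /= H; split; first exact: (H ord0).
    by move=> i; have := H (lift ord0 i); rewrite tnthS.
  by move=> -[/= H0 H1] i; case: (unliftP ord0 i) => [j|] ->//; rewrite tnthS.
rewrite (_ : mkset _ = \bigcap_(i in [set: 'I_n])
    ((@tnth _ rT)^~ i @^-1` A (lift ord0 i))).
  apply: fin_bigcap_measurable => // i _.
  by rewrite -[X in measurable X]setTI; apply: measurable_tnth.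
by apply/funext => t; apply/propext; split => /= H i; [move=> _|]; apply: H.
Qed.
End lebesgue_tuple.

Arguments lebesgue_tuple : clear implicits.

(* k_1, ..., k_r are indexed from 0: k_(j+1) is [k j] for [j : 'I_r].         *)
Definition zetaC (R : realType) (r : nat) (k : 'I_r -> nat) : R :=
  \int[lebesgue_tuple R r]_(x in [set x | forall i, 1 <= tnth x i])
    \prod_(j < r) ((\sum_(i < r | (i <= j)%N) tnth x i) ^+ k j)^-1.

(* With 0-based indices, r - j becomes r - j.+1.                              *)
Definition weight (S : pzRingType) (r : nat) (x : 'I_r -> S) : S :=
  \prod_(j < r) (\sum_(i < r | (j <= i)%N) x i - (2 * (r - j.+1))%:R).

Definition ratfun := {fraction {poly rat}}.

HB.instance Definition _ := GRing.Field.on ratfun.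

Local Notation "x %:F" := (@FracField.tofrac _ x).

Section ratfun_lmodule.

Let scale (c : rat) (f : ratfun) : ratfun := (c%:P)%:F * f.

Let scaleA a b f : scale a (scale b f) = scale (a * b) f.
Proof. by rewrite /scale mulrA -tofracM -polyCM. Qed.

Let scale1 : left_id 1 scale.
Proof. by move=> f; rewrite /scale polyC1 tofrac1 mul1r. Qed.

Let scaleDr : right_distributive scale +%R.
Proof. by move=> c f g; rewrite /scale mulrDr. Qed.

Let scaleDl f : {morph scale^~ f : a b / a + b}.
Proof. by move=> a b; rewrite /scale polyCD tofracD mulrDl. Qed.

HB.instance Definition _ := GRing.Zmodule_isLmodule.Build rat ratfun
  scaleA scale1 scaleDr scaleDl.

End ratfun_lmodule.

(* Evaluation through the reduced form of f, as the representative of f in    *)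
(* the quotient need not be in lowest terms.                                  *)
Definition ratfun_eval (f : ratfun) (t : rat) : rat :=
  let p := (frac (repr f)).1 in let q := (frac (repr f)).2 in
  (p %/ gcdp p q).[t] / (q %/ gcdp p q).[t].

Lemma ratfun_evalE (p q : {poly rat}) (t : rat) : q.[t] != 0 ->
  ratfun_eval (p%:F / q%:F) t = p.[t] / q.[t].
Proof.
move=> qt0; have q0 : q != 0 by apply: contraNneq qt0 => ->; rewrite horner0.
rewrite /ratfun_eval; set f : ratfun := _ / _.
set n := (frac (repr f)).1; set d := (frac (repr f)).2.
have d0 : d != 0 by exact: denom_ratioP.
have e : n * q = d * p.
  have : f * q%:F = p%:F by rewrite /f mulfVK// tofrac_eq0.
  rewrite -[f]reprK; unlock FracField.tofrac.
  rewrite -[X in X = _]FracField.pi_mul.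
  move=> /eqmodP/eqP; rewrite /FracField.mulf !numden_Ratio ?mulr1 ?oner_neq0//.
set g := gcdp n d.
have g0 : g != 0 by rewrite gcdp_eq0 negb_and d0 orbT.
have nE : n %/ g * g = n by rewrite divpK ?dvdp_gcdl.
have dE : d %/ g * g = d by rewrite divpK ?dvdp_gcdr.
have e' : n %/ g * q = d %/ g * p.
  by apply: (mulIf g0); rewrite mulrAC nE e -{1}dE mulrAC.
have cop : coprimep (d %/ g) (n %/ g).
  by rewrite coprimep_sym coprimep_div_gcd// d0 orbT.
have /dvdpP[c qE] : d %/ g %| q.
  by rewrite -(Gauss_dvdpr _ cop) e' dvdp_mulr.
have dt0 : (d %/ g).[t] != 0.
  by apply: contraNneq qt0; rewrite qE hornerM => ->; rewrite mulr0.
apply/eqP; rewrite eqr_div//; apply/eqP.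
by rewrite -hornerM e' hornerM mulrC.
Qed.

Definition simple_fraction (n l : nat) : ratfun :=
  1 / ('X + n%:R)%:F ^+ l.

Definition in_simple_span (f : ratfun) : Prop :=
  exists s : seq (rat * (nat * nat)), all (fun t => (0 < t.2.2)%N) s /\
    f = \sum_(t <- s) t.1 *: simple_fraction t.2.1 t.2.2.

Definition simple_span : {pred ratfun} := fun f => `[< in_simple_span f >].

Fact simple_span_submod_closed : submod_closed simple_span.
Proof.
split; first by apply/asboolP; exists [::]; rewrite big_nil.
move=> c f g /asboolP[s [s0 ->]] /asboolP[t [t0 ->]]; apply/asboolP.
exists ([seq (c * u.1, u.2) | u <- s] ++ t); split.
  by rewrite all_cat all_map; apply/andP.
rewrite big_cat big_map scaler_sumr; congr (_ + _).
by apply: eq_bigr => u _; rewrite scalerA.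
Qed.

HB.instance Definition _ :=
  GRing.isSubmodClosed.Build rat ratfun simple_span simple_span_submod_closed.

Record V := MkV { V_val :> ratfun ; _ : V_val \in simple_span }.

HB.instance Definition _ := [isSub for V_val].
HB.instance Definition _ := [Choice of V by <:].
HB.instance Definition _ := [SubChoice_isSubLmodule of V by <:].

Fact simple_fraction_span (n l : nat) :
  (0 < l)%N -> simple_fraction n l \in simple_span.
Proof.
move=> l0; apply/asboolP; exists [:: (1, (n, l))].
by rewrite /= l0 big_seq1 scale1r.
Qed.

Definition V_fraction (n l : nat) (l_gt0 : (0 < l)%N) : V :=
  MkV (simple_fraction_span n l_gt0).

(* Main.v *)
(* Shift the base point: put Z(k_1, ..., k_r; s) for the integral over        *)
(* [1, +oo)^r of the product of the (s + x_1 + ... + x_j)^(- k_j), so that    *)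
(* zeta^C is Z at s = 0 and, integrating over x_1 last,                       *)
(*   Z(k_1, ..., k_r; s) = int_1^oo (s + x)^(- k_1) Z(k_2, ..., k_r; s + x).  *)
(* By induction on r, the weighted sum of Z(k_1, ..., 1 + k_r; s) over        *)
(* k_1 + ... + k_r = k is eta^(r-1)(1/x^l) at x = s + 1, l = k - 2(r-1), when *)
(* l > 0, and 0 otherwise. The first factor of f is the constant l on the     *)
(* range of summation; if it is pulled out, the induction hypothesis turns    *)
(* the integrand into combinations of                                         *)
(*   sum_(0 < a < l + 2) y^(- a) (y + m + 1)^(- (l + 2 - a))                  *)
(*     = (y^(- (l + 1)) - (y + m + 1)^(- (l + 1))) / (m + 1),   y = s + x,    *)
(* and integrating l times this over x >= 1 gives eta(1/(x + m)^l) at s + 1.  *)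

(* The recursion in the shift [s] is [nested_integralS], which is Tonelli's theorem in the extended
   reals. The bound [nested_integral_le] makes the integrals with positive exponents and last
   exponent above 1 finite, and [has_integral_weighted_sum] sums the recursion over all tuples. The
   induction closes in [weighted_sumE]: [sum_partial_fraction] reduces the integrand to differences
   of shifted powers, which [has_integral_shifted_power] integrates. On the algebraic side
   [iter_etaE] expands the iterate of [eta] over [eta_terms]; the theorem compares the two
   expansions at s = 0, x = 1. *)
Require Import Defs.
From HB Require Import structures.
From mathcomp Require Import all_boot all_order all_algebra.
From mathcomp Require Import all_classical all_reals all_analysis.
From mathcomp Require Import measurable_realfun ring lra zify.
Set Implicit Arguments.
Unset Strict Implicit.
Unset Printing Implicit Defensive.
Import Order.TTheory GRing.Theory Num.Theory.
Local Open Scope ring_scope.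

(** * Nested integrals with a shifted base point *)

Section nested_kernel.
Local Open Scope classical_set_scope.
Context (R : realType).
Local Notation rT := (measurableTypeR R).
Local Notation mu := (@lebesgue_measure R).

(* powR rather than an inverse power keeps the kernel nonnegative for s < 0   *)
(* too, as Tonelli's theorem in (s, t) requires.                              *)
Definition nested_kernel r (k : 'I_r -> nat) (s : R) (t : r.-tuple rT) : R :=
  \prod_(j < r) ((1 <= tnth t j)%R%:R *
    (s + \sum_(i < r | (i <= j)%N) tnth t i) `^ (- (k j)%:R)).

Definition nested_integral r (k : 'I_r -> nat) (s : R) : \bar R :=
  \int[lebesgue_tuple R r]_t (nested_kernel k s t)%:E.

Lemma nested_kernel_ge0 r k s (t : r.-tuple rT) : 0 <= nested_kernel k s t.
Proof. by apply: prodr_ge0 => j _; rewrite mulr_ge0// powR_ge0. Qed.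

Lemma nested_integral_ge0 r (k : 'I_r -> nat) s : (0 <= nested_integral k s)%E.
Proof. by apply: integral_ge0 => t _; rewrite lee_fin nested_kernel_ge0. Qed.

Lemma measurable_nested_kernel r (k : 'I_r -> nat) :
  measurable_fun setT
    (fun p : rT * r.-tuple rT => nested_kernel k p.1 p.2).
Proof.
have mt i : measurable_fun setT (fun p : rT * r.-tuple rT => tnth p.2 i).
  exact: (measurableT_comp (measurable_tnth i) measurable_snd).
apply: measurable_prod => j _; apply: measurable_funM.
  rewrite (_ : (fun p => _) = fun p : rT * r.-tuple rT =>
      if (1 <= tnth p.2 j)%R then 1 else 0).
    apply: measurable_fun_ifT => //; apply: measurable_fun_ler => //.
    exact: mt.
  by apply/funext => p; case: ifP.
have ms : measurable_fun setT (fun p : rT * r.-tuple rT =>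
    p.1 + \sum_(i < r | (i <= j)%N) tnth p.2 i).
  under eq_fun do rewrite big_mkcond/=.
  apply: measurable_funD; first exact: measurable_fst.
  by apply: measurable_sum => i; case: (i <= j)%N => //; exact: mt.
exact: (measurableT_comp (measurable_powR _) ms).
Qed.

Lemma measurable_nested_kernelr r (k : 'I_r -> nat) (s : R) :
  measurable_fun setT (fun t : r.-tuple rT => (nested_kernel k s t)%:E).
Proof.
apply/measurable_EFinP.
exact: (measurableT_comp (measurable_nested_kernel k)
  (pair1_measurable (s : rT))).
Qed.

(** The first variable occurs in every partial sum, so in the remaining factors it is absorbed into
    the base point. *)
Lemma nested_kernel_cons r (k : 'I_r.+1 -> nat) s (p : rT * r.-tuple rT) :
  nested_kernel k s (cons_pair p) =
  (1 <= p.1)%R%:R * (s + p.1) `^ (- (k ord0)%:R) *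
    nested_kernel (fun i => k (lift ord0 i)) (s + p.1) p.2.
Proof.
rewrite /nested_kernel big_ord_recl; congr (_ * _).
  congr (_ * powR _ _); congr (_ + _).
  by rewrite big_mkcond big_ord_recl/= big1 ?addr0.
apply: eq_bigr => j _; rewrite !tnthS; congr (_ * powR _ _).
rewrite big_mkcond big_ord_recl -addrA; congr (_ + (_ + _)).
rewrite [RHS]big_mkcond; apply: eq_bigr => i _.
by rewrite tnthS.
Qed.

Lemma measurable_nested_integral r (k : 'I_r -> nat) :
  measurable_fun setT (fun s : rT => nested_integral k s).
Proof.
have mk : measurable_fun setT
    (fun p : rT * r.-tuple rT => (nested_kernel k p.1 p.2)%:E).
  by apply/measurable_EFinP; exact: measurable_nested_kernel.
apply: (@measurable_fun_fubini_tonelli_F _ _ _ _ _ (lebesgue_tuple R r) _ mk).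
by move=> p; rewrite lee_fin nested_kernel_ge0.
Qed.

Lemma nested_integralS r (k : 'I_r.+1 -> nat) s : 0 <= s ->
  nested_integral k s =
  (\int[mu]_(x in `[1%R, +oo[) (((s + x) ^- k ord0)%:E *
    nested_integral (fun i => k (lift ord0 i)) (s + x)))%E.
Proof.
move=> s0; have mk := measurable_nested_kernelr k s.
rewrite /nested_integral /=.
rewrite (ge0_integral_pushforward (@measurable_cons_pair R r))//; last first.
  by move=> t _; rewrite lee_fin nested_kernel_ge0.
rewrite preimage_setT.
rewrite (@fubini_tonelli1 _ _ _ _ _ mu (lebesgue_tuple R r)); last 2 first.
  exact: measurableT_comp mk (@measurable_cons_pair R r).
  by move=> p; rewrite lee_fin nested_kernel_ge0.
rewrite [RHS]integral_mkcond; apply: eq_integral => x _.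
rewrite /fubini_F/=.
under eq_integral do rewrite nested_kernel_cons/= EFinM.
rewrite ge0_integralZl//=; last 3 first.
- exact: measurable_nested_kernelr.
- by move=> t _; rewrite lee_fin nested_kernel_ge0.
- by rewrite lee_fin mulr_ge0// powR_ge0.
rewrite patchE; case: ifPn; rewrite mem_setE in_itv/= andbT => x1; last first.
  by rewrite (negbTE x1) mul0r mul0e.
by rewrite x1 mul1r powR_invn//; lra.
Qed.

Lemma zetaC_nested r (k : 'I_r -> nat) :
  zetaC R k = fine (nested_integral k 0).
Proof.
rewrite /zetaC /nested_integral Rintegral_mkcond /Rintegral.
congr fine; apply: eq_integral => t _; congr EFin.
rewrite patchE; case: ifPn => [/set_mem/= t1|/negP t1].
  apply: eq_bigr => j _; rewrite t1 mul1r add0r powR_invn//.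
  by apply: sumr_ge0 => i _; apply: le_trans (t1 i).
have /existsNP[j /negP/negbTE tj] : ~ forall j, 1 <= tnth t j.
  by move=> H; apply: t1; exact/mem_set.
by rewrite /nested_kernel (bigD1 j)//= tj mul0r mul0r.
Qed.

End nested_kernel.

(** * The integral of one shifted power *)

Section power_integral.
Import numFieldNormedType.Exports.
Local Open Scope classical_set_scope.
Context (R : realType).
Local Notation mu := (@lebesgue_measure R).

Lemma integral_shifted_power (s : R) (l : nat) : 0 <= s -> (0 < l)%N ->
  (\int[mu]_(x in `[1%R, +oo[) ((s + x) ^- l.+1)%:E =
   (l%:R^-1 * (s + 1) ^- l)%:E)%E.
Proof.
move=> s0 l0.
have dF (x : R) : 1 <= x ->
    is_derive x 1 (fun y => - l%:R^-1 * (s + y) ^- l) ((s + x) ^- l.+1).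
  move=> x1; have sx : s + x != 0 by rewrite gt_eqF//; lra.
  have dX : is_derive x 1 (fun y : R => (s + y) ^+ l)
      ((l%:R * (s + x) ^+ l.-1) *: (0 + 1)).
    have d : is_derive x 1 (fun y : R => s + y) (0 + 1) by exact: is_deriveD.
    by have := is_deriveX l d; rewrite exprfctE.
  have -> : (s + x) ^- l.+1 = - l%:R^-1 *:
     (- ((s + x) ^+ l) ^- 2 *: ((l%:R * (s + x) ^+ l.-1) *: (0 + 1))).
    rewrite /GRing.scale/= add0r mulr1.
    case: l l0 {dX} => // l _ /=; rewrite !exprS expr0.
    have l1 : 1 + l%:R != 0 :> R by rewrite addrC natr1 pnatr_eq0.
    have xl : (s + x) ^+ l != 0 by rewrite expf_neq0.
    by rewrite -natr1; field; rewrite xl sx addrC l1.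
  apply: is_deriveZ; apply: is_deriveV => //; exact: expf_neq0.
have cV n (x : R) : 1 <= x -> (fun y => (s + y) ^- n) @ x --> (s + x) ^- n.
  move=> x1; apply: cvgV; first by rewrite expf_neq0// gt_eqF//; lra.
  apply: (cvg_comp (fun y => s + y) (fun z => z ^+ n)).
    by apply: cvgD; [exact: cvg_cst|exact: cvg_id].
  exact: exprn_continuous.
rewrite (@ge0_continuous_FTC2y _ _ (fun y => - l%:R^-1 * (s + y) ^- l) _ 0).
- by rewrite -EFinB sub0r mulNr opprK.
- by move=> x x1; rewrite invr_ge0 exprn_ge0//; lra.
- apply: continuous_in_subspaceT => x; rewrite inE/= in_itv/= andbT.
  exact: cV.
- rewrite -[X in _ --> X](mulr0 (- l%:R^-1 : R)); apply: cvgMl_tmp.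
  apply/gtr0_cvgV0; first near=> x.
    by rewrite exprn_gt0// ltr_wpDl//; near: x; apply: nbhs_pinfty_gt;
      rewrite num_real.
  apply/cvgryPge => A; near=> x.
  have x1 : 1 <= x by near: x; apply: nbhs_pinfty_ge; rewrite num_real.
  have Ax : A <= x by near: x; apply: nbhs_pinfty_ge; rewrite num_real.
  have sx1 : 1 <= s + x by lra.
  apply: (le_trans Ax); apply: (@le_trans _ _ (s + x)); first lra.
  by rewrite -[leLHS]expr1; exact: ler_weXn2l.
- by move=> x x1; have [] := dF x (ltW x1).
- apply: cvgMl_tmp; apply: cvg_at_right_filter; exact: cV.
- move=> x; rewrite in_itv/= andbT => x1.
  by rewrite derive1E; have /@derive_val -> := dF x (ltW x1).
Unshelve. all: by end_near. Qed.
End power_integral.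

(** * Convergence, and passage to real-valued integrals *)

Section nested_integral_bound.
Local Open Scope classical_set_scope.
Context (R : realType).
Local Notation rT := (measurableTypeR R).
Local Notation mu := (@lebesgue_measure R).

Lemma nested_integral0 (k : 'I_0 -> nat) (s : R) : nested_integral k s = 1%E.
Proof.
rewrite /nested_integral (eq_integral (cst 1%E)); last first.
  by move=> t _; rewrite /nested_kernel big_ord0.
by rewrite integral_cst//= mul1e diracT.
Qed.

Lemma measurable_shifted_power n (s : R) : 0 <= s ->
  measurable_fun (`[1%R, +oo[%classic : set rT) (fun x : rT => (s + x) ^- n).
Proof.
move=> s0; apply: (eq_measurable_fun (fun x : rT => (s + x) `^ (- n%:R))).
  by move=> x; rewrite inE/= in_itv/= andbT => x1; rewrite powR_invn//; lra.
apply: measurable_funTS.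
have ms : measurable_fun setT (fun x : rT => s + x).
  by apply: measurable_funD.
exact: (measurableT_comp (measurable_powR _) ms).
Qed.

Lemma measurable_shifted_nested n r (k : 'I_r -> nat) (s : R) : 0 <= s ->
  measurable_fun (`[1%R, +oo[%classic : set rT) (fun x : rT =>
    (((s + x) ^- n)%:E * nested_integral k (s + x))%E).
Proof.
move=> s0; apply: emeasurable_funM.
  by apply/measurable_EFinP; exact: measurable_shifted_power.
apply: measurable_funTS.
have ms : measurable_fun setT (fun x : rT => s + x).
  by apply: measurable_funD.
exact: (measurableT_comp (measurable_nested_integral k) ms).
Qed.

(* By induction the inner integral at s + x is at most 1 / (s + x), so the    *)
(* integrand is dominated by (s + x)^(- 2).                                   *)
Lemma nested_integral_le r (k : 'I_r.+1 -> nat) (s : R) : 0 <= s ->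
  (forall i, (0 < k i)%N) -> (1 < k ord_max)%N ->
  (nested_integral k s <= ((s + 1)^-1)%:E)%E.
Proof.
elim: r k s => [|r IH] k s s0 k0 k1.
all: rewrite nested_integralS//.
all: have -> : (s + 1)^-1 = 1%N%:R^-1 * (s + 1) ^- 1 by rewrite invr1 mul1r.
all: rewrite -(integral_shifted_power s0)//.
all: apply: ge0_le_integral => //;
  [by move=> x; rewrite /= in_itv/= andbT => x1;
     rewrite mule_ge0 ?nested_integral_ge0// lee_fin invr_ge0 exprn_ge0//; lra
  |exact: measurable_shifted_nested
  |by apply/measurable_EFinP; exact: measurable_shifted_power
  |move=> x; rewrite /= in_itv/= andbT => x1].
all: have sx : 1 <= s + x by lra.
  rewrite nested_integral0 mule1 lee_fin lef_pV2 ?posrE ?exprn_gt0//; try lra.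
  by rewrite ler_weXn2l// (_ : ord0 = ord_max)//; exact: val_inj.
have sx0 : 0 <= s + x by lra.
have := IH (fun i => k (lift ord0 i)) (s + x) sx0 (fun i => k0 _).
rewrite (_ : lift ord0 ord_max = ord_max); last exact: val_inj.
move=> /(_ k1) H; apply: (@le_trans _ _ (((s + x) ^- k ord0)%:E *
  ((s + x + 1)^-1)%:E)%E).
  by apply: lee_wpmul2l => //; rewrite lee_fin invr_ge0 exprn_ge0.
rewrite -EFinM lee_fin -invfM lef_pV2 ?posrE ?mulr_gt0 ?exprn_gt0//; try lra.
rewrite exprSr ler_pM//; try lra.
by rewrite ler_weXn2l.
Qed.

Lemma nested_integral_fin_num r (k : 'I_r.+1 -> nat) (s : R) : 0 <= s ->
  (forall i, (0 < k i)%N) -> (1 < k ord_max)%N ->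
  nested_integral k s \is a fin_num.
Proof.
move=> s0 k0 k1; rewrite ge0_fin_numE ?nested_integral_ge0//.
exact: le_lt_trans (nested_integral_le s0 k0 k1) (ltry _).
Qed.

(** Integrability is bundled with the value so that linearity applies without side conditions, and
    two evaluations of one integrand can be equated by [has_integral_inj]. *)
Definition has_integral (f : R -> R) (v : R) :=
  mu.-integrable `[1, +oo[ (EFin \o f) /\ \int[mu]_(x in `[1, +oo[) f x = v.

Lemma has_integral_inj f u v : has_integral f u -> has_integral f v -> u = v.
Proof. by move=> [_ <-] [_ <-]. Qed.

Lemma eq_has_integral f g v : (forall x, 1 <= x -> f x = g x) ->
  has_integral f v -> has_integral g v.
Proof.
move=> fg; have fg' : {in `[1, +oo[%classic, f =1 g}.
  by move=> x; rewrite inE/= in_itv/= andbT => /fg.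
move=> [fi <-]; split; last by symmetry; exact: eq_Rintegral.
by apply: eq_integrable fi => // x /fg' /= ->.
Qed.

Lemma has_integralZ c f v :
  has_integral f v -> has_integral (fun x => c * f x) (c * v).
Proof.
move=> [fi <-]; split; last exact: RintegralZl.
exact: (integrableZl _ c fi).
Qed.

Lemma has_integralD f g u v : has_integral f u -> has_integral g v ->
  has_integral (fun x => f x + g x) (u + v).
Proof.
move=> [fi <-] [gi <-]; split; last exact: RintegralD.
exact: (integrableD _ fi gi).
Qed.

Lemma has_integral0 : has_integral (cst 0) 0.
Proof. by split; [exact: integrable0|rewrite /Rintegral integral0]. Qed.

Lemma has_integral_sum I (r : seq I) (P : pred I) (f : I -> R -> R)
    (v : I -> R) : (forall i, P i -> has_integral (f i) (v i)) ->
  has_integral (fun x => \sum_(i <- r | P i) f i x) (\sum_(i <- r | P i) v i).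
Proof.
move=> fv; elim: r => [|i r IH].
  rewrite big_nil; apply: (@eq_has_integral (cst 0)).
    by move=> x _; rewrite big_nil.
  exact: has_integral0.
rewrite big_cons; have [Pi|nPi] := boolP (P i).
  apply: eq_has_integral (has_integralD (fv i Pi) IH) => x _.
  by rewrite big_cons Pi.
by apply: eq_has_integral IH => x _; rewrite big_cons (negbTE nPi).
Qed.

Lemma has_integral_shifted_power (s : R) l : 0 <= s -> (0 < l)%N ->
  has_integral (fun x => (s + x) ^- l.+1) (l%:R^-1 * (s + 1) ^- l).
Proof.
move=> s0 l0; have E := integral_shifted_power s0 l0.
split; last by rewrite /Rintegral E.
apply/integrableP; split.
  by apply/measurable_EFinP; exact: measurable_shifted_power.
suff -> : (\int[mu]_(x in `[1%R, +oo[) `|((s + x) ^- l.+1)%:E| =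
    (l%:R^-1 * (s + 1) ^- l)%:E)%E by rewrite ltry.
rewrite -E; apply: eq_integral => x.
rewrite inE/= in_itv/= andbT => x1.
by rewrite ger0_norm// invr_ge0 exprn_ge0//; lra.
Qed.

Lemma has_integral_nested r (k : 'I_r.+2 -> nat) (s : R) : 0 <= s ->
  (forall i, (0 < k i)%N) -> (1 < k ord_max)%N ->
  has_integral (fun x => (s + x) ^- k ord0 *
    fine (nested_integral (fun i => k (lift ord0 i)) (s + x)))
  (fine (nested_integral k s)).
Proof.
move=> s0 k0 k1; have kfin := nested_integral_fin_num s0 k0 k1.
have E : {in `[1, +oo[%classic, forall x : R,
    (((s + x) ^- k ord0)%:E *
      nested_integral (fun i => k (lift ord0 i)) (s + x) =
    ((s + x) ^- k ord0 *
      fine (nested_integral (fun i => k (lift ord0 i)) (s + x)))%:E)%E}.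
  move=> x; rewrite inE/= in_itv/= andbT => x1.
  rewrite EFinM fineK//; apply: nested_integral_fin_num => //; first lra.
  by rewrite (_ : lift ord0 ord_max = ord_max)//; exact: val_inj.
split; last
  by rewrite /Rintegral nested_integralS//; congr fine; exact/esym/eq_integral.
apply: eq_integrable; [by []|exact: E|apply/integrableP; split].
  exact: measurable_shifted_nested.
(* The integrand is nonnegative, so the integral of its absolute value is the nested integral
   itself, already known to be finite. *)
rewrite [ltLHS](_ : _ = nested_integral k s).
  by rewrite -ge0_fin_numE// nested_integral_ge0.
rewrite nested_integralS//; apply: eq_integral.
move=> x; rewrite inE/= in_itv/= andbT => x1; rewrite gee0_abs//.
by rewrite mule_ge0 ?nested_integral_ge0// lee_fin invr_ge0 exprn_ge0//; lra.
Qed.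

End nested_integral_bound.

(** * Iterates of eta and evaluation of rational functions *)

(* eta^p(1/x^l) is the sum of the c/(x + m)^l for (c, m) in eta_terms p; the  *)
(* coefficients do not depend on l.                                           *)
Fixpoint eta_terms p : seq (rat * nat) :=
  if p is q.+1 then
    flatten [seq [:: (t.1 / t.2.+1%:R, 0%N); (- (t.1 / t.2.+1%:R), t.2.+1)]
            | t <- eta_terms q]
  else [:: (1, 0%N)].

Lemma sum_eta_termsS (A : nmodType) (F : rat -> nat -> A) p :
  \sum_(t <- eta_terms p.+1) F t.1 t.2 =
  \sum_(t <- eta_terms p) (F (t.1 / t.2.+1%:R) 0%N +
                           F (- (t.1 / t.2.+1%:R)) t.2.+1).
Proof.
rewrite /= big_flatten/= big_map; apply: eq_bigr => t _.
by rewrite big_cons big_seq1.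
Qed.

Lemma iter_etaE (eta : {linear V -> V})
    (etaE : forall (n l : nat) (l_gt0 : (0 < l)%N),
      eta (V_fraction n l_gt0) =
      n.+1%:R^-1 *: (V_fraction 0 l_gt0 - V_fraction n.+1 l_gt0))
    p l (l_gt0 : (0 < l)%N) :
  iter p eta (V_fraction 0 l_gt0) =
  \sum_(t <- eta_terms p) t.1 *: V_fraction t.2 l_gt0.
Proof.
elim: p => [|p IH]; first by rewrite /= big_seq1 scale1r.
rewrite iterS IH (sum_eta_termsS (fun c n => c *: V_fraction n l_gt0)).
rewrite linear_sum; apply: eq_bigr => t _.
by rewrite linearZ/= etaE scalerA scaleNr -scalerBr.
Qed.

(** Any fraction with denominator nonzero at [t] is allowed, which makes closure under linear
    combinations immediate; this is not visible from the reduced form behind [ratfun_eval]. *)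
Definition evaluates_to (f : ratfun) (t v : rat) :=
  exists p q : {poly rat}, [/\ q.[t] != 0,
    f = FracField.tofrac p / FracField.tofrac q & v = p.[t] / q.[t]].

Lemma evaluates_toE f t v : evaluates_to f t v -> ratfun_eval f t = v.
Proof. by move=> [p [q [qt -> ->]]]; exact: ratfun_evalE. Qed.

Lemma evaluates_to0 t : evaluates_to 0 t 0.
Proof.
exists 0, 1; rewrite hornerC oner_neq0; split=> //.
  by rewrite tofrac0 mul0r.
by rewrite horner0 mul0r.
Qed.

Lemma evaluates_toD f g t u v : evaluates_to f t u -> evaluates_to g t v ->
  evaluates_to (f + g) t (u + v).
Proof.
have nz (q : {poly rat}) : q.[t] != 0 -> FracField.tofrac q != 0.
  by rewrite tofrac_eq0; apply: contraNneq => ->; rewrite horner0.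
move=> [p [q [qt -> ->]]] [p' [q' [qt' -> ->]]].
exists (p * q' + p' * q), (q * q'); split.
- by rewrite hornerM mulf_neq0.
- by rewrite addf_div ?nz// !(tofracM, tofracD).
- by rewrite addf_div// !(hornerM, hornerD).
Qed.

Lemma evaluates_toZ c f t v : evaluates_to f t v ->
  evaluates_to (c *: f) t (c * v).
Proof.
move=> [p [q [qt -> ->]]]; exists (c%:P * p), q; split => //.
  by rewrite tofracM -mulrA.
by rewrite hornerM hornerC mulrA.
Qed.

Lemma evaluates_to_simple_fraction n l (t : rat) : t + n%:R != 0 ->
  evaluates_to (simple_fraction n l) t ((t + n%:R) ^- l).
Proof.
move=> tn; exists 1, (('X + n%:R) ^+ l).
have -> : (('X + n%:R : {poly rat}) ^+ l).[t] = (t + n%:R) ^+ l.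
  by rewrite horner_exp hornerD hornerX -polyC_natr hornerC.
split; first exact: expf_neq0.
  by rewrite /simple_fraction tofrac1 tofracXn.
by rewrite hornerC mul1r.
Qed.

Lemma evaluates_to_sum s l (l_gt0 : (0 < l)%N) (t : rat) : 0 < t ->
  evaluates_to (\sum_(u <- s) u.1 *: V_fraction u.2 l_gt0 : V) t
    (\sum_(u <- s) u.1 * (t + u.2%:R) ^- l).
Proof.
move=> t0; elim: s => [|u s IH].
  by rewrite !big_nil; exact: evaluates_to0.
rewrite !big_cons; apply: evaluates_toD IH.
apply: evaluates_toZ; apply: evaluates_to_simple_fraction.
by rewrite gt_eqF// ltr_wpDr.
Qed.

(** * Splitting off the first exponent, and partial fractions *)

Definition ffun_cons r (T : Type) (a : T) (K : {ffun 'I_r -> T}) :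
    {ffun 'I_r.+1 -> T} :=
  [ffun i => if unlift ord0 i is Some j then K j else a].

Lemma ffun_cons0 r (T : Type) (a : T) (K : {ffun 'I_r -> T}) :
  ffun_cons a K ord0 = a.
Proof. by rewrite ffunE unlift_none. Qed.

Lemma ffun_consS r (T : Type) (a : T) (K : {ffun 'I_r -> T}) i :
  ffun_cons a K (lift ord0 i) = K i.
Proof. by rewrite ffunE liftK. Qed.

Lemma sum_ffun_ordS (A : nmodType) (T : finType) r
    (F : {ffun 'I_r.+1 -> T} -> A) :
  \sum_K F K = \sum_a \sum_K F (ffun_cons a K).
Proof.
rewrite pair_big/= (reindex (fun p => ffun_cons p.1 p.2))//.
exists (fun K : {ffun 'I_r.+1 -> T} =>
    (K ord0, [ffun i => K (lift ord0 i)])) => [[a K] _|K _].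
  rewrite /= ffun_cons0; congr pair; apply/ffunP => i.
  by rewrite ffunE ffun_consS.
apply/ffunP => i; case: (unliftP ord0 i) => [j|] -> /=.
  by rewrite ffun_consS ffunE.
by rewrite ffun_cons0.
Qed.

(** The first variable occurs only in the first factor of the product. *)
Lemma weightS (S : pzRingType) r (x : 'I_r.+1 -> S) :
  weight x = (\sum_i x i - (2 * r)%:R) * weight (fun i => x (lift ord0 i)).
Proof.
rewrite /weight big_ord_recl subSS subn0; congr (_ * _).
apply: eq_bigr => j _; congr (_ - _).
by rewrite big_mkcond big_ord_recl/= add0r [RHS]big_mkcond.
Qed.

(* Truncation makes both sides vanish for L <= 1.                             *)
Lemma sum_partial_fraction (R : numFieldType) (y d : R) L : 0 < y -> 0 < d ->
  \sum_(1 <= a < L) y ^- a * (y + d) ^- (L - a) =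
  d^-1 * (y ^- L.-1 - (y + d) ^- L.-1).
Proof.
move=> y0 d0; have yd0 : 0 < y + d by rewrite addr_gt0.
have [|L0] := leqP L 1.
  by case: L => [|[|//]] _; rewrite big_geq// subrr mulr0.
(* The summand is d^(-1) (h(a + 1) - h(a)), because (y + d) - y = d; the sum telescopes. *)
pose h a := y ^- a.-1 * (y + d) ^- (L - a).
transitivity (\sum_(1 <= a < L) d^-1 * (h a.+1 - h a)).
  apply: eq_big_nat => -[//|a] /andP[_ aL]; rewrite /h/=.
  rewrite -(subnSK aL) !exprS; set u := y ^+ a; set v := (y + d) ^+ _.
  have u0 : u != 0 by rewrite expf_neq0// gt_eqF.
  have v0 : v != 0 by rewrite expf_neq0// gt_eqF.
  by field; rewrite u0 v0 !gt_eqF.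
rewrite -mulr_sumr telescope_sumr; last exact: ltnW.
by rewrite /h subnn subn1 !expr0 invr1 mul1r mulr1.
Qed.

(** * Weighted sums and the induction on depth *)

Section weighted_sum.
Context (R : realType).

(* The bound N on the exponents is kept apart from their sum k, since k       *)
(* changes in the induction on n.                                             *)
Definition weighted_sum (N n k : nat) (s : R) : R :=
  \sum_(K : {ffun 'I_n.+1 -> 'I_N.+1} |
        [forall i, (0 < K i)%N] && (\sum_i K i == k)%N)
    weight (fun i => (K i)%:R) *
      fine (nested_integral (fun i => (K i + (i == n :> nat))%N) s).

(** The value of eta^n(1/x^l) at a real point, since the induction evaluates it at s + x + 1 under
    the integral. *)
Definition eta_value (n l : nat) (x : R) :=
  \sum_(t <- eta_terms n) ratr t.1 * (x + t.2%:R) ^- l.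

(** The only tuple is (k), present when k > 0; its weight k cancels the 1/k from integrating the
    power k + 1. *)
Lemma weighted_sum0 N k (s : R) : 0 <= s -> (k <= N)%N ->
  weighted_sum N 0 k s = if (0 < k)%N then (s + 1) ^- k else 0.
Proof.
move=> s0 kN; rewrite /weighted_sum.
have [k0|] := ltnP 0 k; last first.
  rewrite leqn0 => /eqP ->; rewrite big1// => K /andP[/forallP/(_ ord0)].
  by rewrite big_ord1 => /[swap]/eqP ->.
rewrite (big_pred1 [ffun => inord k]); last first.
  move=> K; apply/idP/eqP => [/andP[_]|->].
    rewrite big_ord1 => /eqP Kk; apply/ffunP => i.
    by rewrite ffunE ord1 -Kk inord_val.
  rewrite big_ord1 ffunE inordK ?ltnS// eqxx andbT.
  by apply/forallP => i; rewrite ffunE inordK ?ltnS.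
rewrite /weight big_ord1 big_ord1_cond/= ffunE inordK ?ltnS// subnn muln0 subr0.
rewrite nested_integralS//.
under eq_integral do rewrite nested_integral0 mule1 ffunE inordK ?ltnS// addn1.
rewrite integral_shifted_power//= mulrA divff ?mul1r//.
by rewrite pnatr_eq0 -lt0n.
Qed.

(** Here [a] is the first exponent. The leading factor of the weight depends only on the total k,
    and the other factors and the extra 1 in the last exponent belong to the tail. *)
Lemma has_integral_weighted_sum N n k (s : R) : 0 <= s -> (k <= N)%N ->
  has_integral (fun x => (k%:R - (2 * n.+1)%:R) *
    \sum_(1 <= a < k.+1) (s + x) ^- a * weighted_sum N n (k - a) (s + x))
  (weighted_sum N n.+1 k s).
Proof.
move=> s0 kN.
apply: eq_has_integral; last first.
  apply: has_integral_sum => K /andP[/forallP K0 _].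
  apply: has_integralZ; apply: has_integral_nested => // [i|].
    by rewrite addn_gt0 K0.
  by rewrite eqxx addn1 ltnS K0.
move=> x x1; rewrite [LHS]big_mkcond [LHS]sum_ffun_ordS/=.
transitivity (\sum_(a < N.+1 | (0 < a <= k)%N)
   (k%:R - (2 * n.+1)%:R) *
   ((s + x) ^- a * weighted_sum N n (k - a) (s + x))); last first.
  rewrite -mulr_sumr; congr (_ * _).
  rewrite (big_nat_widen _ _ N.+1)// (big_nat_widenl _ 0)// big_mkord.
  by apply: eq_bigl => a; rewrite ltnS andbC.
rewrite [RHS]big_mkcond; apply: eq_bigr => a _.
have E K : [forall i, (0 < ffun_cons a K i)%N] &&
    (\sum_i ffun_cons a K i == k)%N = (0 < a <= k)%N &&
    ([forall i, (0 < K i)%N] && (\sum_i K i == k - a)%N).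
  have -> : (\sum_i ffun_cons a K i = a + \sum_i K i)%N.
    rewrite big_ord_recl ffun_cons0; congr addn.
    by apply: eq_bigr => i _; rewrite ffun_consS.
  have -> : [forall i, (0 < ffun_cons a K i)%N] =
      (0 < a)%N && [forall i, (0 < K i)%N].
    apply/forallP/andP => [H|[a0 /forallP H] i].
      split; first by have := H ord0; rewrite ffun_cons0.
      by apply/forallP => i; have := H (lift ord0 i); rewrite ffun_consS.
    by case: (unliftP ord0 i) => [j|] ->; rewrite ?ffun_consS ?ffun_cons0.
  rewrite -!andbA; congr (_ && _); rewrite [RHS]andbCA; congr (_ && _).
  by apply/eqP/andP => [<-|[ak /eqP ->]]; rewrite ?leq_addr ?addKn ?subnKC.
under eq_bigr do rewrite E.
case: ifP => /= ak; last by rewrite big1.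
rewrite -big_mkcond /weighted_sum/= !mulr_sumr; apply: eq_bigr => K.
move=> /andP[_ /eqP Kk]; rewrite weightS.
have -> : \sum_i (ffun_cons a K i)%:R = k%:R :> R.
  rewrite big_ord_recl ffun_cons0 (eq_bigr (fun i => (K i)%:R)).
    by rewrite -natr_sum Kk -natrD subnKC//; case/andP: ak.
  by move=> i _; rewrite ffun_consS.
rewrite ffun_cons0 addn0.
have -> : (fun i => (ffun_cons a K (lift ord0 i) +
    (lift ord0 i == n.+1 :> nat))%N) = (fun i => K i + (i == n :> nat))%N.
  by apply/funext => i; rewrite ffun_consS.
have -> : (fun i => (ffun_cons a K (lift ord0 i))%:R) = (fun i => (K i)%:R : R).
  by apply/funext => i; rewrite ffun_consS.
by rewrite -!mulrA; congr (_ * _); rewrite mulrCA.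
Qed.

Lemma weighted_sumE N n k (s : R) : 0 <= s -> (k <= N)%N ->
  weighted_sum N n k s =
  if (2 * n < k)%N then eta_value n (k - 2 * n) (s + 1) else 0.
Proof.
elim: n k s => [|n IH] k s s0 kN.
  rewrite muln0 subn0 weighted_sum0// /eta_value /= big_seq1/= rmorph1 mul1r.
  by rewrite addr0.
(* It remains to show that the integrand of the recursion also integrates to the right-hand side. *)
apply: has_integral_inj (has_integral_weighted_sum _ s0 kN) _.
pose L := (k - 2 * n)%N.
pose term (t : rat * nat) (x : R) := ratr t.1 * (t.2.+1%:R^-1 *
  (x ^- L.-1 - (x + t.2.+1%:R) ^- L.-1)).
apply: (@eq_has_integral _ (fun x => (k%:R - (2 * n.+1)%:R) *
    \sum_(t <- eta_terms n) term t (s + x))).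
  move=> x x1; congr (_ * _); have sx0 : 0 < s + x by lra.
  (* By the induction hypothesis only a < k - 2n contributes. Each term of [eta_value] then gives a
     partial fraction sum with y = s + x and d = m + 1. *)
  transitivity (\sum_(1 <= a < L) (s + x) ^- a *
      eta_value n (L - a) (s + x + 1)).
    under [RHS]eq_bigr do rewrite /eta_value mulr_sumr.
    rewrite exchange_big/=; apply: eq_bigr => t _; rewrite /term.
    rewrite -sum_partial_fraction// mulr_sumr; apply: eq_bigr => a _.
    rewrite mulrCA (_ : s + x + t.2.+1%:R = s + x + 1 + t.2%:R)//.
    by rewrite -natr1; ring.
  rewrite [RHS](eq_big_nat _ _ (F2 := fun a => if (a < L)%N then
     (s + x) ^- a * eta_value n (L - a) (s + x + 1) else 0)).
    rewrite -big_mkcond/= (big_nat_widen 1 L k.+1)//.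
    exact: leq_trans (leq_subr _ _) (leqnSn _).
  move=> a /andP[a0 ak]; rewrite IH ?(ltW sx0)//; last first.
    exact: leq_trans (leq_subr _ _) kN.
  rewrite ltn_subRL addnC -ltn_subRL -/L; case: ifP; rewrite ?mulr0//.
  by rewrite /L subnAC.
(* When k <= 2(n + 1) the integrand vanishes: through the leading factor at equality, and otherwise
   because the exponent [L.-1] is 0. *)
have [kn|kn] := ltnP (2 * n.+1) k; last first.
  apply: eq_has_integral (has_integral0 R) => x _ /=.
  move: kn; rewrite leq_eqVlt => /orP[/eqP ->|kn]; first by rewrite subrr mul0r.
  rewrite big1 ?mulr0// => t _; rewrite /term (_ : L.-1 = 0%N).
    by rewrite !expr0 subrr !mulr0.
  by rewrite /L; lia.
have [l l0 [lE LE]] : exists2 l, (0 < l)%N &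
    (k - 2 * n.+1 = l)%N /\ (L.-1 = l.+1)%N.
  by exists (k - 2 * n.+1)%N; rewrite /L; lia.
have lR : k%:R - (2 * n.+1)%:R = l%:R :> R by rewrite -natrB ?lE// ltnW.
have l_neq0 : l%:R != 0 :> R by rewrite pnatr_eq0 -lt0n.
rewrite lE lR /eta_value.
rewrite (sum_eta_termsS (fun c m => ratr c * (s + 1 + m%:R) ^- l)).
(* The factors l and 1/l are kept apart so that the value matches termwise integration; the second
   power is integrated from base point s + d. *)
rewrite (_ : \sum_(t <- _) _ = l%:R * \sum_(t <- eta_terms n) ratr t.1 *
  (t.2.+1%:R^-1 * (l%:R^-1 * (s + 1) ^- l +
   -1 * (l%:R^-1 * (s + t.2.+1%:R + 1) ^- l)))).
  apply/has_integralZ/has_integral_sum => t _; rewrite /term LE.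
  do 2!apply: has_integralZ.
  apply: (@eq_has_integral _ (fun x => (s + x) ^- l.+1 +
      -1 * (s + t.2.+1%:R + x) ^- l.+1)).
    by move=> x _; rewrite mulN1r addrAC.
  apply: has_integralD; first exact: has_integral_shifted_power.
  by apply/has_integralZ/has_integral_shifted_power => //; rewrite addr_ge0.
rewrite mulr_sumr; apply: eq_bigr => t _.
rewrite rmorphN !fmorph_div/= !ratr_nat addr0 [s + _ + 1]addrAC.
have : t.2.+1%:R != 0 :> R by rewrite pnatr_eq0.
move: t.2.+1%:R => d d0; move: ((s + 1) ^- l) ((s + 1 + d) ^- l) => A B.
by field; rewrite l_neq0.
Qed.

End weighted_sum.

Theorem theorem1p4 (R : realType) (r k : nat) (r_ge2 : (2 <= r)%N)
    (k_gt : (2 * (r - 1) < k)%N) (eta : {linear V -> V})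
    (etaE : forall (n l : nat) (l_gt0 : (0 < l)%N),
      eta (V_fraction n l_gt0) =
      n.+1%:R^-1 *: (V_fraction 0 l_gt0 - V_fraction n.+1 l_gt0)) :
  \sum_(K : {ffun 'I_r -> 'I_k.+1} |
        [forall i, (0 < K i)%N] && (\sum_(i < r) K i == k)%N)
    weight (fun i => (K i)%:R) *
      zetaC R (fun i : 'I_r => (K i + (i == r.-1 :> nat))%N) =
  ratr (ratfun_eval
    (iter (r - 1) eta (V_fraction 0 (etrans (subn_gt0 (2 * (r - 1)) k) k_gt)))
    1).
Proof.
rewrite iter_etaE// (evaluates_toE (evaluates_to_sum _ _ ltr01)).
case: r r_ge2 k_gt => // n _; rewrite subn1/= => k_gt.
transitivity (weighted_sum k n k (0 : R)).
  by apply: eq_bigr => K _; rewrite zetaC_nested.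
rewrite weighted_sumE// k_gt add0r /eta_value rmorph_sum.
apply: eq_bigr => t _.
by rewrite rmorphM fmorphV rmorphXn rmorphD rmorph1 /= ratr_nat.
Qed.
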